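(* Let $(X,T),(Y,S)$ be topological dynamical systems and $f\in C(X\times Y)$. (a) If $(X,T)$ and $(Y,S)$ both have the periodic specification property, then $\alpha(f)\le\delta(f)$. (b) If $(Y,S)$ has the periodic specification property, then $\alpha(f)\ge\delta(f)$. In particular, if both have the periodic specification property, then $\alpha(f)=\delta(f)$.
   Context: A topological dynamical system $(X,T)$: $X$ compact metrizable, $T$ a homeomorphism; $\mathcal{M}_T(X)$ its invariant Borel probability measures. With $\pi_Y(x,y)=y$: $\psi_f(\nu)=\min\{\int f\,d\lambda:\lambda\in\mathcal{M}_{T\times S}(X\times Y),(\pi_Y)_*\lambda=\nu\}$, $\alpha(f)=\sup_{\nu\in\mathcal{M}_S(Y)}\psi_f(\nu)$, and $\delta(f)=\limsup_{k\to\infty}\max_{y\in Y}\min_{x\in X}\frac1k\sum_{j=0}^{k-1}f(T^jx,S^jy)$. A specification in $X$ is $\xi=(x_i,[a_i,b_i])_{i=1}^n$ with integers $a_1\le b_1<a_2\le\dots<a_n\le b_n$; $D$-spaced if $a_{i+1}-b_i\ge D$; $x$ is an $\eta$-tracing if $d(T^jx,T^jx_i)<\eta$ for all $i$, $j\in[a_i,b_i]$ ($d$ a compatible metric). $(X,T)$ has the periodic specification property if for each $\eta>0$ there is $D(\eta)\in\mathbb{N}$ such that every $D(\eta)$-spaced specification has an $\eta$-tracing $x'$ with $T^{b_n-a_1+D(\eta)}x'=x'$. *)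

(* Defs.v *)
From HB Require Import structures.
From mathcomp Require Import all_boot all_order all_algebra.
From mathcomp Require Import all_classical all_reals all_analysis.
Set Implicit Arguments. Unset Strict Implicit. Unset Printing Implicit Defensive.
Import Order.TTheory GRing.Theory Num.Theory.
Import numFieldNormedType.Exports.
Local Open Scope classical_set_scope.
Local Open Scope ring_scope.

Notation borel T := (g_sigma_algebraType (@open T%type)).

Definition iterZ (X : Type) (T Tinv : X -> X) (j : int) (x : X) : X :=
  match j with
  | Posz n => iter n T x
  | Negz n => iter n.+1 Tinv x
  end.

(** Periodic specification property of (X,T), T homeomorphism with inverse Tinv.
    A specification is (x_i, [a_i, b_i])_{i<n} (indices shifted to 0..n-1),
    with a_i <= b_i < a_{i+1}; it is D-spaced if a_{i+1} - b_i >= D.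
    "d(u,v) < eta" is expressed with the metric balls of X: [ball u eta v]. *)
Definition periodic_specification (R : realType) (X : pseudoPMetricType R)
    (T Tinv : X -> X) : Prop :=
  forall eta : R, 0 < eta ->
  exists D : nat,
  forall (n : nat) (xs : nat -> X) (a b : nat -> int),
    (0 < n)%N ->
    (forall i, (i < n)%N -> a i <= b i) ->
    (forall i, (i.+1 < n)%N -> b i < a i.+1) ->
    (forall i, (i.+1 < n)%N -> (D%:Z <= a i.+1 - b i)) ->
    exists x' : X,
      (forall i, (i < n)%N -> forall j : int, a i <= j <= b i ->
         ball (iterZ T Tinv j (xs i)) eta (iterZ T Tinv j x')) /\
      iterZ T Tinv (b n.-1 - a 0%N + D%:Z) x' = x'.

Definition invariant_measure (R : realType) (d : measure_display)
    (M : measurableType d) (U : M -> M) (mu : probability M R) : Prop :=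
  forall A : set M, measurable A -> mu (U @^-1` A) = mu A.

Definition prod_map (X Y : Type) (T : X -> X) (S : Y -> Y) (z : X * Y) : X * Y :=
  (T z.1, S z.2).

Definition invariant_lift (R : realType) (X Y : pseudoPMetricType R)
    (T : X -> X) (S : Y -> Y) (nu : probability (borel Y) R)
    (lam : probability (borel (X * Y)%type) R) : Prop :=
  @invariant_measure R _ (borel (X * Y)) (prod_map T S) lam /\
  (forall A : set (borel Y), measurable A ->
     lam ((@snd X Y) @^-1` A) = nu A).

Local Open Scope ereal_scope.

Definition psi (R : realType) (X Y : pseudoPMetricType R)
    (T : X -> X) (S : Y -> Y) (f : X * Y -> R) (nu : probability (borel Y) R)
    : \bar R :=
  ereal_inf [set \int[lam]_z (f z)%:E | lam in invariant_lift T S nu].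

Definition alpha (R : realType) (X Y : pseudoPMetricType R)
    (T : X -> X) (S : Y -> Y) (f : X * Y -> R) : \bar R :=
  ereal_sup [set psi T S f nu | nu in @invariant_measure R _ (borel Y) S].

Definition delta (R : realType) (X Y : pseudoPMetricType R)
    (T : X -> X) (S : Y -> Y) (f : X * Y -> R) : \bar R :=
  limn_esup (fun k : nat =>
    ereal_sup [set ereal_inf [set
        ((k%:R)^-1 * \sum_(0 <= j < k) f (iter j T x, iter j S y))%R%:E
      | x in [set: X]] | y in [set: Y]]).

(* Main.v *)
(* alpha <= delta, for an S-invariant nu and c > delta: for long K pick x(y) with
   Birkhoff average of f over K steps at (x(y), y) at most c, and spread nu over
   the orbit segments of the points (x(q y), q y), where q is a finite-valued
   measurable choice of centres that shadow y for K steps. The resulting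
   positive functionals have almost the right marginal and are almost invariant;
   an ultrafilter limit is exactly so, and by the Riesz representation theorem
   it is integration against a lift of nu that gives f an integral at most c.

   delta <= alpha, for c < delta: take y whose Birkhoff averages over a long
   segment are at least c for every x, close the segment to a periodic orbit by
   specification, and let nu be uniform on that orbit. Every lift of nu lives
   above the orbit, where the long averages of f are at least about c. *)
Require Import Defs.
From HB Require Import structures.
From mathcomp Require Import all_boot all_order all_algebra.
From mathcomp Require Import all_classical all_reals all_analysis.
From mathcomp Require Import measurable_realfun ring lra.
Import Order.TTheory GRing.Theory Num.Theory.
Import numFieldNormedType.Exports.
Local Open Scope classical_set_scope.
Local Open Scope ring_scope.
Set Implicit Arguments. Unset Strict Implicit.

(** * Compact pseudometric spaces *)

Section CompactSpaces.
Context {R : realType} {Z : pseudoMetricType R}.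
Hypothesis cptZ : compact [set: Z].
Implicit Types (g : Z -> R).

Lemma continuous_bounded g : continuous g ->
  exists2 M : R, 0 < M & forall z, `|g z| <= M.
Proof.
move=> cg; have : compact (g @` setT).
  by apply: continuous_compact => //; exact: continuous_subspaceT.
move=> /compact_bounded [M [_ HM]]; exists (`|M| + 1).
  by rewrite ltr_wpDl.
move=> z; apply: (HM (`|M| + 1)); first by rewrite ltr_pwDr// ler_norm.
by exists z.
Qed.

(** Uniform continuity through the near-covering form of compactness: near [x] the radius [r / 2]
    works, since two steps of that size stay in the ball of radius [r] on which [g] varies by less
    than [e / 2]. *)
Lemma continuous_unif g (e : R) : continuous g -> 0 < e ->
  exists2 d : R, 0 < d & forall x y, ball x d y -> `|g x - g y| < e.
Proof.
move=> cg e0.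
have /compact_near_coveringP cov := cptZ.
have := cov R 0^'+ (fun d x => forall y, ball x d y -> `|g x - g y| < e) _.
have H : forall x : Z, setT x -> \forall x' \near x & d \near 0^'+,
    forall y, ball x' d y -> `|g x' - g y| < e.
  move=> x _.
  have /cvgrPdist_lt/(_ (e / 2)) := cg x.
  rewrite divr_gt0// => /(_ isT) /nbhs_ballP[r /= r0 Hr].
  exists (ball x (r / 2), [set d | d < r / 2]).
    split => /=; first by apply: nbhsx_ballx; rewrite divr_gt0.
    by apply: nbhs_right_lt; rewrite divr_gt0.
  move=> [x' d] /= [xx' dr] y x'y.
  have h1 : `|g x - g x'| < e / 2.
    apply: Hr; apply: le_ball xx'.
    by rewrite ler_pdivrMr// ler_peMr ?ler1n// ltW.
  have h2 : `|g x - g y| < e / 2.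
    apply: Hr; rewrite [r]splitr; apply: ball_triangle xx' _ => /=.
    by apply: le_ball x'y; exact: ltW.
  by rewrite ltr_norml; move: h1 h2; rewrite !ltr_norml; lra.
move=> /(_ _ H) Hn.
have : \forall d \near 0^'+, 0 < d /\ (forall x y : Z, ball x d y -> `|g x - g y| < e).
  near=> d; split; first by near: d; exact: nbhs_right_gt.
  have : setT `<=` (fun x : Z => forall y, ball x d y -> `|g x - g y| < e).
    by near: d; exact: Hn.
  by move=> + x; apply.
by move=> /filter_ex[d [d0 dP]]; exists d.
Unshelve. all: by end_near. Qed.
End CompactSpaces.

(** * Cutoff functions of closed sets *)

Section ClosedCutoffs.
Context {R : realType} {Z : pseudoMetricType R}.

(** The function is the distance to [F], which is infinite when [F] is empty; [contract] makes it
    real and finite without moving its zeros. A point at distance zero is in the closure of [F]. *)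
Lemma closed_zero_set (F : set Z) : closed F ->
  exists phi : Z -> R, [/\ continuous phi, forall z, 0 <= phi z &
    forall z, phi z = 0 <-> F z].
Proof.
move=> cF; exists (fun z => contract (edist_inf F z)); split.
- move=> z; apply: (@continuous_comp _ _ _ (edist_inf F) (@contract R)).
    exact: edist_inf_continuous.
  by apply/cvgrPdist_lt => e e0; apply/(@nbhs_ballP R (\bar R)); exists e.
- by move=> z; rewrite -contract0 le_contract edist_inf_ge0.
- move=> z; split => [/eqP|Fz]; last by rewrite edist_inf0// contract0.
  rewrite contract_eq0 => /eqP z0; apply: cF => B /nbhs_ballP[e /= e0 eB].
  have : (edist_inf F z < e%:E)%E by rewrite z0 lte_fin.
  move=> /ereal_inf_lt[_ [a Fa <-]] /edist_lt_ball /= za.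
  by exists a; split => //; exact: eB.
Qed.

(** Truncating [1 - n * phi] at zero gives functions that off [F] do not merely tend to zero but
    vanish from some index on, namely once [n] exceeds the inverse of [phi z]. *)
Lemma closed_cutoffs (F : set Z) : closed F ->
  exists phi : nat -> Z -> R, [/\ forall n, continuous (phi n),
    forall n z, 0 <= phi n z <= 1,
    forall m n z, (m <= n)%N -> phi n z <= phi m z,
    forall n z, F z -> phi n z = 1 &
    forall z, ~ F z -> exists N, forall n, (N <= n)%N -> phi n z = 0].
Proof.
move=> /closed_zero_set[phi [cphi phi0 phiF]].
exists (fun n z => Num.max 0 (1 - n%:R * phi z)); split.
- move=> n z; apply: (@continuous_max _ _ (cst 0) (fun z => 1 - n%:R * phi z));
    first exact: cvg_cst.
  apply: cvgB; first exact: cvg_cst.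
  by apply: cvgMr; exact: cphi.
- move=> n z; rewrite le_max lexx/= ge_max ler01/= gerBl.
  by rewrite mulr_ge0.
- move=> m n z mn; rewrite ge_max le_max lexx/= le_max.
  by rewrite lerB ?orbT// ler_wpM2r// ler_nat.
- move=> n z /phiF ->; rewrite mulr0 subr0; apply/max_idPr; exact: ler01.
- move=> z nF; have pz : 0 < phi z.
    by rewrite lt0r phi0 andbT; apply/eqP => /phiF.
  exists (Num.truncn (phi z)^-1).+1 => n Nn; apply/max_idPl.
  rewrite subr_le0 -ler_pdivrMr// div1r; apply: le_trans (ltW (truncnS_gt _)) _.
  by rewrite ler_nat.
Qed.
End ClosedCutoffs.

(** * Positive functionals on continuous functions *)

Section ContinuousFunctions.
Context {R : realType} {Z : topologicalType}.
Implicit Types g h : Z -> R.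

Lemma continuous_lin (a : R) g h : continuous g -> continuous h ->
  continuous (fun z => a * g z + h z).
Proof. by move=> cg ch z; apply: cvgD; [apply: cvgMr; exact: cg|exact: ch]. Qed.

Lemma continuous_mul g h : continuous g -> continuous h ->
  continuous (fun z => g z * h z).
Proof. by move=> cg ch z; apply: cvgM; [exact: cg|exact: ch]. Qed.

Lemma continuous_sum (n : nat) (h : nat -> Z -> R) :
  (forall i, continuous (h i)) -> continuous (fun z => \sum_(i < n) h i z).
Proof.
move=> ch; elim: n => [|n IH].
  by under eq_fun do rewrite big_ord0; move=> z; exact: cvg_cst.
under eq_fun do rewrite big_ord_recr/=.
by move=> z; apply: cvgD; [exact: IH|exact: ch].
Qed.

(** A normalised positive linear functional on C(Z), taken as a map on all functions so that
    continuity need not be bundled; its values on discontinuous functions are unconstrained. *)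
Record positive_functional (L : (Z -> R) -> R) : Prop := PositiveFunctional {
  pf_lin : forall a g h, continuous g -> continuous h ->
    L (fun z => a * g z + h z) = a * L g + L h ;
  pf_ge0 : forall g, continuous g -> (forall z, 0 <= g z) -> 0 <= L g ;
  pf_1 : L (fun=> 1) = 1 }.
End ContinuousFunctions.

Section PositiveFunctionalTheory.
Context {R : realType} {Z : topologicalType} (L : (Z -> R) -> R).
Hypothesis HL : positive_functional L.
Implicit Types g h : Z -> R.

Let ccst (c : R) : continuous (fun _ : Z => c). Proof. by move=> z; exact: cvg_cst. Qed.

Lemma pf_0 : L (fun=> 0) = 0.
Proof.
rewrite (_ : (fun=> 0) = fun z => -1 * (fun=> 1) z + (fun _ : Z => 1) z).
  by rewrite (pf_lin HL)// (pf_1 HL); ring.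
by apply/funext => z; ring.
Qed.

Lemma pfD g h : continuous g -> continuous h -> L (fun z => g z + h z) = L g + L h.
Proof.
move=> cg ch; rewrite -[L g]mul1r -(pf_lin HL)//.
by congr L; apply/funext => z; ring.
Qed.

Lemma pfZ (a : R) g : continuous g -> L (fun z => a * g z) = a * L g.
Proof.
move=> cg; rewrite -[RHS]addr0 -pf_0 -(pf_lin HL)//.
by congr L; apply/funext => z; ring.
Qed.

Lemma pf_cst (c : R) : L (fun=> c) = c.
Proof.
rewrite -[RHS]mulr1 -(pf_1 HL) -pfZ//.
by congr L; apply/funext => z; ring.
Qed.

Lemma pf_le g h : continuous g -> continuous h -> (forall z, g z <= h z) ->
  L g <= L h.
Proof.
move=> cg ch gh; rewrite -subr_ge0 addrC -mulN1r -(pf_lin HL)//.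
apply: (pf_ge0 HL); first exact: continuous_lin.
by move=> z; rewrite mulN1r addrC subr_ge0.
Qed.

Lemma pf_sum (n : nat) (h : nat -> Z -> R) : (forall i, continuous (h i)) ->
  L (fun z => \sum_(i < n) h i z) = \sum_(i < n) L (h i).
Proof.
move=> ch; elim: n => [|n IH].
  by rewrite big_ord0 -[RHS]pf_0; congr L; apply/funext => z; rewrite big_ord0.
rewrite big_ord_recr/= -IH -pfD//; last exact: continuous_sum.
by congr L; apply/funext => z; rewrite big_ord_recr.
Qed.
End PositiveFunctionalTheory.

(** Compactness of [[-M, M]] gives a cluster point. It is a limit, because the ultrafilter contains
    the preimage of each neighbourhood or its complement, and the complement would contradict
    clustering. *)
Lemma ultra_bounded_cvg {R : realType} (U : set_system nat) (u : nat -> R) (M : R) :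
  UltraFilter U -> (forall n, `|u n| <= M) -> exists l : R, u @ U --> l.
Proof.
move=> UU uM.
have UP : ProperFilter (u @ U) by apply: fmap_proper_filter; exact: ultra_proper.
have /(_ _ UP)[] := @segment_compact R (- M) M.
  have : U (u @^-1` `[- M, M]) by apply: filterE => n; rewrite /= in_itv/= -ler_norml.
  exact.
move=> l [_ cl]; exists l => B nB.
have [//|UB] := in_ultra_setVsetC (u @^-1` B) UU.
by have [x []] := cl _ _ (UB : (u @ U) (~` B)) nB.
Qed.

(** Weak-star compactness: one ultrafilter finer than [\oo] makes all the bounded sequences [Ln n g]
    converge at once, so no subsequence is extracted. Linearity, positivity and eventual bounds pass
    to the limit. *)
Lemma pf_ultralimit {R : realType} {Z : pseudoMetricType R}
    (Ln : nat -> (Z -> R) -> R) :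
  compact [set: Z] -> (forall n, positive_functional (Ln n)) ->
  exists2 L, positive_functional L & forall g c, continuous g ->
    (\forall n \near \oo, Ln n g <= c) -> L g <= c.
Proof.
move=> cptZ HLn.
have [U [UU sU]] := @ultraFilterLemma nat \oo _.
have UP : ProperFilter U := ultra_proper.
have Lcvg g : continuous g -> Ln n g @[n --> U] --> lim (Ln n g @[n --> U]).
  move=> cg; have [M M0 gM] := continuous_bounded cptZ cg.
  suff [l] : exists l : R, Ln n g @[n --> U] --> l by move=> /cvgP.
  apply: (@ultra_bounded_cvg _ U _ M) => n.
  have cc (c : R) : continuous (fun _ : Z => c) by move=> z; exact: cvg_cst.
  rewrite ler_norml; apply/andP; split.
    rewrite -(pf_cst (HLn n) (- M)); apply: (pf_le (HLn n)) => // z.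
    by have := gM z; rewrite ler_norml => /andP[].
  rewrite -(pf_cst (HLn n) M); apply: (pf_le (HLn n)) => // z.
  by have := gM z; rewrite ler_norml => /andP[].
exists (fun g => lim (Ln n g @[n --> U])); first split.
- move=> a g h cg ch; apply: cvg_lim => //.
  under eq_fun do rewrite (pf_lin (HLn _))//.
  by apply: cvgD; [apply: cvgMr; exact: Lcvg|exact: Lcvg].
- move=> g cg g0; apply: limr_ge; first by apply/cvg_ex; eexists; exact: Lcvg.
  by apply: filterE => n; exact: (pf_ge0 (HLn n)).
- apply: cvg_lim => //; under eq_fun do rewrite (pf_1 (HLn _)).
  exact: cvg_cst.
- move=> g c cg gc; apply: limr_le; first by apply/cvg_ex; eexists; exact: Lcvg.
  exact: sU.
Qed.

(** * The Riesz representation theorem *)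

Section RieszOuterMeasure.
Context {R : realType} {Z : pseudoPMetricType R} (L : (Z -> R) -> R).

(* The constant sequences g alone would give the usual approximation of compact
   sets; increasing sequences make the outer measure countably subadditive by
   diagonal sums, without series of real numbers. *)
Definition covering (g : nat -> Z -> R) (c : R) (A : set Z) : Prop :=
  [/\ forall k, continuous (g k), forall k z, 0 <= g k z,
      forall k l z, (k <= l)%N -> g k z <= g l z, forall k, L (g k) <= c &
      forall z, A z -> forall e, 0 < e -> exists k, 1 - e < g k z].

Definition riesz_outer (A : set Z) : \bar R :=
  ereal_inf [set c%:E | c in [set c | exists g, covering g c A]].

Hypothesis HL : positive_functional L.
Hypothesis cptZ : compact [set: Z].

Let ccst (c : R) : continuous (fun _ : Z => c). Proof. by move=> z; exact: cvg_cst. Qed.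

Lemma riesz_outer_le g c A : covering g c A -> (riesz_outer A <= c%:E)%E.
Proof. by move=> gcA; apply: ereal_inf_lbound; exists c => //; exists g. Qed.

Lemma riesz_outer_le_fun (g : Z -> R) A : continuous g -> (forall z, 0 <= g z) ->
  (forall z, A z -> 1 <= g z) -> (riesz_outer A <= (L g)%:E)%E.
Proof.
move=> cg g0 gA; apply: (@riesz_outer_le (fun=> g)); split => // z Az e e0.
by exists 0%N; have := gA z Az; lra.
Qed.

Lemma riesz_outer_ge0 A : (0 <= riesz_outer A)%E.
Proof.
apply: le_ereal_inf_tmp => _ [c [g [cg g0 _ gc _]] <-].
by rewrite lee_fin; apply: le_trans (gc 0%N); exact: (pf_ge0 HL).
Qed.

Lemma riesz_outer_le1 A : (riesz_outer A <= 1)%E.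
Proof.
apply: le_trans (@riesz_outer_le_fun (fun=> 1) A _ _ _) _ => //.
by rewrite (pf_1 HL).
Qed.

Lemma riesz_outer_fin A : riesz_outer A \is a fin_num.
Proof.
rewrite ge0_fin_numE ?riesz_outer_ge0//.
by rewrite (le_lt_trans (riesz_outer_le1 A))// ltry.
Qed.

Lemma riesz_outer_adherent A (e : R) : 0 < e ->
  exists g c, covering g c A /\ (c%:E < riesz_outer A + e%:E)%E.
Proof.
move=> e0; have [_ [c [g gcA] <-] ce] := lb_ereal_inf_adherent e0 (riesz_outer_fin A).
by exists g, c.
Qed.

Lemma riesz_outer0 : riesz_outer set0 = 0%E.
Proof.
apply/eqP; rewrite eq_le riesz_outer_ge0 andbT.
by rewrite -[X in (_ <= X%:E)%E](pf_0 HL); apply: riesz_outer_le_fun.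
Qed.

Lemma riesz_outer_mono : {homo riesz_outer : A B / A `<=` B >-> (A <= B)%E}.
Proof.
move=> A B AB; apply: ereal_inf_le_tmp => _ [c [g [cg g0 gm gc gB]] <-].
by exists c => //; exists g; split => // z /AB; exact: gB.
Qed.

(** Choose for each [F i] a covering within [e / 2 ^ i.+1] of its outer measure. The diagonal sums,
    adding for [i < k] the [k]-th function of the [i]-th covering, increase in [k], cost at most
    [S], and cover the union. *)
Lemma riesz_outer_sigma_subadditive : sigma_subadditive riesz_outer.
Proof.
move=> F; apply/lee_addgt0Pr => e e0.
have ge0 i : (0 <= riesz_outer (F i))%E := riesz_outer_ge0 _.
have := epsilon_trick xpredT ge0 (ltW e0).
set S := (\sum_(i <oo) riesz_outer (F i) + e%:E)%E => leS.
have ei i : 0 < e / (2 ^ i.+1)%:R by rewrite divr_gt0// ltr0n expn_gt0.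
have /choice[G] : forall i, exists gc : (nat -> Z -> R) * R,
    covering gc.1 gc.2 (F i) /\
    (gc.2%:E < riesz_outer (F i) + (e / (2 ^ i.+1)%:R)%:E)%E.
  by move=> i; have [g [c]] := riesz_outer_adherent (F i) (ei i); exists (g, c).
move=> /all_and2[Gcov Gc].
have Gsum k : ((\sum_(i < k) (G i).2)%:E <= S)%E.
  apply: le_trans leS; rewrite -sumEFin.
  apply: (@le_trans _ _ (\sum_(0 <= i < k)
      (riesz_outer (F i) + (e / (2 ^ i.+1)%:R)%:E))%E); last first.
    by apply: nneseries_lim_ge => n _ _; rewrite adde_ge0// lee_fin ltW.
  by rewrite big_mkord; apply: lee_sum => i _; exact: ltW.
have [Soo|Sfin] := eqVneq S +oo%E; first by rewrite Soo leey.
have Sr : S = (fine S)%:E.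
  rewrite fineK// ge0_fin_numE ?ltey//.
  by apply: adde_ge0; [exact: nneseries_ge0|rewrite lee_fin ltW].
rewrite Sr; apply: (@riesz_outer_le (fun k z => \sum_(i < k) (G i).1 k z)).
split.
- by move=> k; apply: (@continuous_sum _ _ k (fun i => (G i).1 k)) => i; have [] := Gcov i.
- by move=> k z; apply: sumr_ge0 => i _; have [_ ->] := Gcov i.
- move=> k l z kl; rewrite -!(big_mkord xpredT (fun i => (G i).1 _ z)).
  rewrite (big_cat_nat _ kl)//= -[leLHS]addr0 lerD//.
    by apply: ler_sum => i _; have [_ _ + _ _] := Gcov i; apply.
  by apply: sumr_ge0 => i _; have [_ ->] := Gcov i.
- move=> k; rewrite (@pf_sum _ _ _ HL k (fun i => (G i).1 k)); last first.
    by move=> i; have [] := Gcov i.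
  rewrite -lee_fin -Sr; apply: le_trans (Gsum k); rewrite lee_fin.
  by apply: ler_sum => i _; have [_ _ _ + _] := Gcov i; apply.
- move=> z [i _ Fz] r r0; have [_ Gi0 Gim _ Gia] := Gcov i.
  (* The index must reach [k], where the [i]-th covering is large at [z], and exceed [i], so that
     this covering enters the sum. *)
  have [k kr] := Gia z Fz r r0; exists (maxn k i.+1).
  apply: lt_le_trans kr _; apply: le_trans (Gim k (maxn k i.+1) z (leq_maxl _ _)) _.
  have ik : (i < maxn k i.+1)%N by rewrite leq_maxr.
  rewrite (bigD1 (Ordinal ik))//= lerDl; apply: sumr_ge0 => j _.
  by have [_ ->] := Gcov j.
Qed.

(* If g_k covers X at cost c and phi_k are cutoffs decreasing to the indicator of
   F, then g_k (1 - phi_k) covers the part of X off F, at a cost b, and g_k phi_m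
   covers the part in F; for an m almost attaining b the second cost is at most
   about c - b. *)
Lemma riesz_outer_closed (F X : set Z) : closed F ->
  (riesz_outer (X `&` F) + riesz_outer (X `&` ~` F) <= riesz_outer X)%E.
Proof.
move=> /closed_cutoffs[phi [cphi phi01 phim phiF phinF]].
apply/lee_addgt0Pr => e e0; have e20 : 0 < e / 2 by rewrite divr_gt0.
have [g [c [[cg g0 gm gc gX] ce]]] := riesz_outer_adherent X e20.
pose h k z := g k z * (1 - phi k z).
have cph n : continuous (fun z => 1 - phi n z).
  by move=> z; apply: cvgB; [exact: cvg_cst|exact: cphi].
have ch k : continuous (h k) by apply: continuous_mul.
have h0 k z : 0 <= h k z.
  by rewrite mulr_ge0// subr_ge0; have /andP[] := phi01 k z.
have hm k l z : (k <= l)%N -> h k z <= h l z.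
  move=> kl; apply: ler_pM => //; first by rewrite subr_ge0; have /andP[] := phi01 k z.
    exact: gm.
  by rewrite lerB// phim.
have hc k : L (h k) <= c.
  apply: le_trans (gc k); apply: (pf_le HL) => // z.
  by rewrite /h mulrBr mulr1 gerBl mulr_ge0//; have /andP[] := phi01 k z.
pose b := sup (range (fun k => L (h k))).
have hasb : has_sup (range (fun k => L (h k))).
  by split; [exists (L (h 0%N)), 0%N | exists c => _ [k _ <-]].
have hb k : L (h k) <= b by apply: sup_ubound; [case: hasb|exists k].
have [_ [m _ <-] /= mb] := sup_adherent e20 hasb.
have bcov : covering h b (X `&` ~` F).
  split => // z [Xz nF] r r0; have [k kr] := gX z Xz r r0.
  have [N HN] := phinF z nF; exists (maxn k N).
  rewrite /h HN ?leq_maxr// subr0 mulr1; apply: lt_le_trans kr _.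
  by rewrite gm// leq_maxl.
have acov : covering (fun k z => g k z * phi m z) (c - b + e / 2) (X `&` F).
  split.
  - by move=> k; apply: continuous_mul.
  - by move=> k z; rewrite mulr_ge0//; have /andP[] := phi01 m z.
  - by move=> k l z kl; rewrite ler_wpM2r ?gm//; have /andP[] := phi01 m z.
  (* At the common index [maxn k m] the function splits into its [phi m] part and the rest. The rest
     dominates [h m], whose value exceeds [b - e / 2], which leaves at most [c - b + e / 2] for the
     first part. *)
  - move=> k; have kq : (k <= maxn k m)%N by rewrite leq_maxl.
    have mq : (m <= maxn k m)%N by rewrite leq_maxr.
    have h1 : L (fun z => g k z * phi m z) <= L (fun z => g (maxn k m) z * phi m z).
      apply: (pf_le HL); try by apply: continuous_mul.
      by move=> z; rewrite ler_wpM2r ?gm//; have /andP[] := phi01 m z.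
    have h2 : L (h m) <= L (fun z => g (maxn k m) z * (1 - phi m z)).
      apply: (pf_le HL) => //; first by apply: continuous_mul.
      by move=> z; rewrite ler_wpM2r ?gm// subr_ge0; have /andP[] := phi01 m z.
    have h3 : L (fun z => g (maxn k m) z * phi m z) +
        L (fun z => g (maxn k m) z * (1 - phi m z)) = L (g (maxn k m)).
      rewrite -(pfD HL); try by apply: continuous_mul.
      by congr L; apply/funext => z; ring.
    by have := gc (maxn k m); rewrite -/b in mb; lra.
  - move=> z [Xz Fz] r r0; have [k kr] := gX z Xz r r0.
    by exists k; rewrite phiF// mulr1.
apply: le_trans (leeD (riesz_outer_le acov) (riesz_outer_le bcov)) _.
rewrite -EFinD (_ : c - b + e / 2 + b = c + e / 2); last by ring.
rewrite [e in leRHS]splitr EFinD EFinD addeA leeD2r//.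
exact: ltW.
Qed.

(** A Dini argument: a covering of the whole space increases and exceeds [1 - e] at each point
    eventually, so by compactness a single [g k] exceeds [1 - e] everywhere and the cost is at least
    [1 - e]. *)
Lemma riesz_outerT : riesz_outer setT = 1%E.
Proof.
apply/eqP; rewrite eq_le riesz_outer_le1/=.
apply: le_ereal_inf_tmp => _ [c [g [cg g0 gm gc gT]] <-].
rewrite lee_fin; apply/ler_addgt0Pr => e e0; rewrite -lerBlDr.
have /compact_near_coveringP cov := cptZ.
have : \forall k \near \oo, [set: Z] `<=` (fun z => 1 - e < g k z).
  apply: cov => z _; have [k ke] := gT z I e e0.
  have nz : \forall z' \near z, 1 - e < g k z'.
    by have /cvgr_gt := cg k z; apply.
  exists ([set z' | 1 - e < g k z'], [set l | (k <= l)%N]) => /=.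
    by split => //; exists k.
  by move=> [z' l] /= [h1 h2]; apply: lt_le_trans h1 _; exact: gm.
move=> /filter_ex[k Hk]; apply: le_trans (gc k).
rewrite -(pf_cst HL (1 - e)); apply: (pf_le HL) => // z.
by apply: ltW; exact: Hk.
Qed.
End RieszOuterMeasure.

(** * Borel measures tested on continuous functions *)

Section BorelMaps.
Context {R : realType}.

Lemma borel_measurable_map {Z W : pseudoPMetricType R} (u : Z -> W) :
  continuous u -> measurable_fun [set: borel Z] (u : borel Z -> borel W).
Proof.
move=> /continuousP cu; apply: (@measurability _ _ (borel Z) (borel W) setT u (@open W)) => //.
move=> _ [B oB <-]; rewrite setTI; apply: sub_sigma_algebra; exact: cu.
Qed.

Lemma borel_measurable_fun {Z : pseudoPMetricType R} (g : Z -> R) :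
  continuous g -> measurable_fun [set: borel Z] (g : borel Z -> R).
Proof.
move=> /continuousP cg; apply: (measurability _ (RGenOpens.measurableE R)).
move=> _ [_ [a [b ->] <-]]; rewrite setTI; apply: sub_sigma_algebra.
exact/cg/interval_open.
Qed.

Lemma continuous_integrable {Z : pseudoPMetricType R}
    (mu : probability (borel Z) R) (g : Z -> R) :
  compact [set: Z] -> continuous g -> mu.-integrable setT (EFin \o g).
Proof.
move=> cptZ cg; have [M M0 gM] := continuous_bounded cptZ cg.
apply: measurable_bounded_integrable => //.
- by have := ltry (1 : R); rewrite -(probability_setT mu).
- exact: borel_measurable_fun.
- by exists M; split; [exact: num_real|move=> x Mx z _; exact: le_trans (gM z) (ltW Mx)].
Qed.

(** Open sets form a generating class closed under intersection. The measure of an open set is, by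
    monotone convergence, the limit of the integrals of [1 - phi n], with [phi] the cutoffs of its
    complement. *)
Lemma borel_measure_unique {W : pseudoPMetricType R}
    (m1 m2 : {measure set (borel W) -> \bar R}) :
  (m1 setT < +oo)%E ->
  (forall h : W -> R, continuous h -> (forall w, 0 <= h w <= 1) ->
     (\int[m1]_w (h w)%:E = \int[m2]_w (h w)%:E)%E) ->
  forall A : set (borel W), measurable A -> m1 A = m2 A.
Proof.
move=> m1oo m12.
have cvgU (m : {measure set (borel W) -> \bar R}) (U : set W)
    (phi : nat -> W -> R) : open U ->
    (forall n, continuous (phi n)) -> (forall n z, 0 <= phi n z <= 1) ->
    (forall k n z, (k <= n)%N -> phi n z <= phi k z) ->
    (forall n z, (~` U) z -> phi n z = 1) ->
    (forall z, ~ (~` U) z -> exists N, forall n, (N <= n)%N -> phi n z = 0) ->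
    (\int[m]_w (1 - phi n w)%R%:E)%E @[n --> \oo] --> m U.
  move=> oU cphi phi01 phim phiF phinF.
  have mU : measurable (U : set (borel W)) by exact: sub_sigma_algebra.
  rewrite -[X in m X]setIT -(integral_indic m measurableT)//.
  pose g n (w : borel W) : \bar R := (1 - phi n w)%:E.
  have -> : (\int[m]_w (\1_U w)%:E = \int[m]_w limn (g ^~ w))%E.
    apply: eq_integral => w _; apply/esym/cvg_lim => //.
    apply: cvg_near_cst; have [Uw|nUw] := pselect (U w).
      have [N HN] := phinF w (fun nU => nU Uw).
      exists N => // n /= Nn; rewrite /g HN// subr0 indicE mem_set//.
    by exists 0%N => // n _; rewrite /g phiF// subrr indicE memNset.
  apply: cvg_monotone_convergence => //.
  - move=> n; apply/measurable_EFinP; apply: (@borel_measurable_fun W (fun w => 1 - phi n w)).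
    by move=> z; apply: cvgB; [exact: cvg_cst|exact: cphi].
  - by move=> n w _; rewrite lee_fin subr_ge0; have /andP[] := phi01 n w.
  - by move=> w _ k n kn; rewrite lee_fin lerB// phim.
apply: (@g_sigma_algebra_measure_unique _ R (borel W) (@open W) _ (fun=> setT)).
- by move=> A oA; exact: sub_sigma_algebra.
- by move=> _; exact: openT.
- by rewrite bigcup_const.
- by move=> A B; exact: openI.
- move=> U oU; have cU : closed (~` U) by rewrite closedC.
  have [phi [cphi phi01 phim phiF phinF]] := closed_cutoffs cU.
  have := cvgU m1 _ _ oU cphi phi01 phim phiF phinF.
  rewrite (_ : (fun n => _) = (fun n => \int[m2]_w (1 - phi n w)%R%:E)%E).
    move=> h1; apply: (cvg_unique _ h1) => //; exact: cvgU.
  apply/funext => n; apply: (m12 (fun w => 1 - phi n w)) => [z|w].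
    by apply: cvgB; [exact: cvg_cst|exact: cphi].
  by have := phi01 n w; lra.
- by [].
Qed.

(** Serves twice for the lift: with [u] the product map it yields invariance, with [u] the
    projection it yields the marginal. *)
Lemma borel_pushforward_unique {Z W : pseudoPMetricType R} (u : Z -> W)
    (mu : probability (borel Z) R) (nu : probability (borel W) R) :
  continuous u ->
  (forall h : W -> R, continuous h ->
     (\int[mu]_z (h (u z))%:E = \int[nu]_w (h w)%:E)%E) ->
  forall B : set (borel W), measurable B -> mu (u @^-1` B) = nu B.
Proof.
move=> cu hu B mB; have mu_ := borel_measurable_map cu.
pose pm : {measure set (borel W) -> \bar R} := pushforward mu (u : borel Z -> borel W).
suff : pm mu_ B = nu B by [].
apply: (@borel_measure_unique W (pm mu_) nu) => //.
  by rewrite /pm /= /pushforward preimage_setT (probability_setT mu) ltry.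
move=> h ch h01; rewrite -hu// ge0_integral_pushforward//.
- by apply/measurable_EFinP; exact: (@borel_measurable_fun W h).
- by move=> w _; rewrite lee_fin; have /andP[] := h01 w.
Qed.
End BorelMaps.

(** * The Borel probability of a positive functional *)

Section RieszMeasure.
Context {R : realType} {Z : pseudoPMetricType R} (L : (Z -> R) -> R).
Hypothesis HL : positive_functional L.
Hypothesis cptZ : compact [set: Z].

(** By [riesz_outer_closed] closed sets, hence Borel sets, are Caratheodory measurable, so the outer
    measure is countably additive on them; its total mass is [riesz_outerT]. *)
Lemma riesz_measure : exists mu : probability (borel Z) R,
  forall A : set Z, mu A = riesz_outer L A.
Proof.
pose mo : {outer_measure set Z -> \bar R} := HB.pack (riesz_outer L)
  (isOuterMeasure.Build R Z (riesz_outer L) (riesz_outer0 HL) (riesz_outer_ge0 HL)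
    (@riesz_outer_mono R Z L) (riesz_outer_sigma_subadditive HL)).
have cara (A : set (borel Z)) : measurable A -> mo.-cara.-measurable A.
  apply: smallest_sub.
    exact: (@sigma_algebra_measurable _ (caratheodory_type mo)).
  move=> U oU; rewrite -(setCK U).
  apply: caratheodory_measurable_setC; apply: le_caratheodory_measurable => X.
  by apply: (riesz_outer_closed HL); rewrite closedC.
have sadd : semi_sigma_additive (riesz_outer L : set (borel Z) -> \bar R).
  move=> F mF tF mUF.
  apply: (@caratheodory_measure_sigma_additive R Z mo F) => //.
    by move=> n; exact: cara.
  exact: cara.
pose m : {measure set (borel Z) -> \bar R} := HB.pack (riesz_outer L : set (borel Z) -> \bar R)
  (isMeasure.Build _ (borel Z) R (riesz_outer L : set (borel Z) -> \bar R)
    (riesz_outer0 HL) (riesz_outer_ge0 HL) sadd).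
pose mu : probability (borel Z) R := HB.pack (riesz_outer L : set (borel Z) -> \bar R)
  (Measure.class m)
  (Measure_isProbability.Build _ (borel Z) R m (riesz_outerT HL cptZ)).
by exists mu.
Qed.
End RieszMeasure.

(** * Integration against the representing measure *)

Section RieszRepresentation.
Context {R : realType} {Z : pseudoPMetricType R} (L : (Z -> R) -> R).
Hypothesis HL : positive_functional L.
Hypothesis cptZ : compact [set: Z].

(** Layer-cake bound: the sum rounds the truncated [x] down to a multiple of [e], and the extra [e]
    absorbs the rounding. *)
Lemma layers_le (x e : R) (n : nat) : 0 < e -> 0 <= x ->
  Num.min x (n.+1%:R * e) <= e + \sum_(i < n) e * (i.+1%:R * e <= x)%R%:R.
Proof.
move=> e0 x0; elim: n => [|n IH].
  by rewrite big_ord0 addr0 mul1r ge_min lexx orbT.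
rewrite big_ord_recr/= addrA.
have [le|gt] := leP (n.+1%:R * e) x.
  rewrite mulr1; apply: le_trans (lerD IH (lexx e)).
  by rewrite (min_r le) ge_min -[n.+2]addn1 natrD mulrDl mul1r lexx orbT.
rewrite mulr0 addr0; apply: le_trans IH; rewrite (min_l (ltW gt)).
by rewrite ge_min lexx.
Qed.

(** Cut [f] into horizontal layers [g i] of height [e]. Since [g i / e] is at least 1 on [A i], it
    bounds the outer measure there, so [e * mu (A i)] is at most [L (g i)]. Summing by [layers_le]
    gives the claim up to [e]. *)
Lemma riesz_integral_le (mu : probability (borel Z) R) (f : Z -> R) :
  (forall A : set Z, mu A = riesz_outer L A) ->
  continuous f -> (forall z, 0 <= f z) ->
  (\int[mu]_z (f z)%:E <= (L f)%:E)%E.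
Proof.
move=> muE cf f0; apply/lee_addgt0Pr => e e0.
have [M M0 fM] := continuous_bounded cptZ cf.
pose n := (Num.truncn (M / e)).+1.
have fn z : f z <= n%:R * e.
  rewrite -ler_pdivrMr//; apply: le_trans (ltW (truncnS_gt _)).
  by rewrite ler_pM2r ?invr_gt0//; apply: le_trans (fM z); exact: ler_norm.
pose t (i : nat) z := Num.min (f z) (i%:R * e).
have ct i : continuous (t i).
  move=> z; apply: (@continuous_min _ _ f (cst (i%:R * e))); first exact: cf.
  exact: cvg_cst.
pose g (i : nat) z := t i.+1 z - t i z.
have cg i : continuous (g i) by move=> z; apply: cvgB; exact: ct.
have tm i z : t i z <= t i.+1 z.
  by rewrite le_min2// ler_wpM2r ?ler_nat// ltW.
have sumg : L f = \sum_(i < n) L (g i).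
  rewrite -(pf_sum HL)//; congr L; apply/funext => z.
  rewrite -(big_mkord xpredT (g ^~ z)) telescope_sumr// /t.
  by rewrite (min_l (fn z)) mul0r (min_r (f0 z)) subr0.
pose A (i : nat) : set (borel Z) := [set z | i.+1%:R * e <= f z].
have clA i : closed (A i : set Z).
  rewrite (_ : A i = f @^-1` [set x | i.+1%:R * e <= x])//.
  by apply: closed_comp => [z _|]; [exact: cf|exact: closed_ge].
have mA i : measurable (A i).
  by rewrite -(setCK (A i)); apply: measurableC; apply: sub_sigma_algebra;
     rewrite /= openC.
have muA i : (e%:E * mu (A i) <= (L (g i))%:E)%E.
  rewrite muE; have : (riesz_outer L (A i) <= (L (fun z => e^-1 * g i z))%:E)%E.
    apply: riesz_outer_le_fun.
    - by move=> z; apply: cvgMr; exact: cg.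
    - by move=> z; rewrite /g mulr_ge0 ?invr_ge0 ?(ltW e0)// subr_ge0.
    - move=> z; rewrite /A/= => Az; rewrite ler_pdivlMl// mulr1 /g /t.
      rewrite (min_r Az) min_r; last by apply: le_trans Az; rewrite ler_wpM2r ?ler_nat// ltW.
      by rewrite -mulrBl -natrB// subSnn mul1r.
  move=> /(lee_wpmul2l (x := e%:E)); rewrite lee_fin => /(_ (ltW e0)) /le_trans; apply.
  by rewrite (pfZ HL)// -EFinM mulrA mulfV ?gt_eqF// mul1r.
have mi i : measurable_fun setT (fun z : borel Z => (e * \1_(A i) z)%:E).
  by apply/measurable_EFinP; apply: measurable_funM => //; exact: measurable_indic.
have i0 i (z : borel Z) : (0 <= (e * \1_(A i) z)%:E)%E.
  by rewrite lee_fin mulr_ge0// ltW.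
apply: (@le_trans _ _ (\int[mu]_z (e%:E + \sum_(i < n) (e * \1_(A i) z)%R%:E))%E).
  apply: ge0_le_integral => //.
  - by move=> z _; rewrite lee_fin.
  - by apply/measurable_EFinP; exact: (@borel_measurable_fun R Z f).
  - by apply: emeasurable_funD => //; exact: emeasurable_sum.
  - move=> z _; rewrite sumEFin lee_fin.
    have fnz : f z <= t n.+1 z.
      by rewrite le_min lexx/= (le_trans (fn z))// ler_wpM2r ?ler_nat// ltW.
    apply: (le_trans fnz).
    apply: le_trans (layers_le n e0 (f0 z)) _; rewrite lerD2l.
    by apply: ler_sum => i _; rewrite indicE /A mem_setE.
rewrite ge0_integralD//; last 3 first.
- by move=> z _; rewrite lee_fin ltW.
- by move=> z _; exact: sume_ge0.
- exact: emeasurable_sum.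
rewrite integral_cst// [X in (_ * X)%E](probability_setT mu) mule1 addeC leeD2r//.
rewrite ge0_integral_sum// sumg -sumEFin; apply: lee_sum => i _.
apply: le_trans (muA i).
under eq_integral do rewrite EFinM.
rewrite ge0_integralZl_EFin//; last 2 first.
- by apply/measurable_EFinP; exact: measurable_indic.
- exact: ltW.
by rewrite integral_indic// setIT.
Qed.

(** The one-sided bound suffices: adding a constant extends it from nonnegative to all continuous
    functions, and applying it to [- f] reverses it. *)
Theorem riesz_representation : exists mu : probability (borel Z) R,
  forall f : Z -> R, continuous f -> (\int[mu]_z (f z)%:E = (L f)%:E)%E.
Proof.
have [mu muE] := riesz_measure HL cptZ; exists mu.
have le f : continuous f -> (\int[mu]_z (f z)%:E <= (L f)%:E)%E.
  move=> cf; have [M M0 fM] := continuous_bounded cptZ cf.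
  have cc (c : R) : continuous (fun _ : Z => c) by move=> z; exact: cvg_cst.
  have cfM : continuous (fun z => f z + M).
    by move=> z; apply: cvgD; [exact: cf|exact: cvg_cst].
  have := riesz_integral_le muE cfM; rewrite (pfD HL)// (pf_cst HL).
  have -> : (\int[mu]_z (f z + M)%:E = \int[mu]_z (f z)%:E + M%:E)%E.
    under eq_integral do rewrite EFinD.
    rewrite integralD//; try exact: continuous_integrable.
    by rewrite integral_cst// [X in (_ + _ * X)%E](probability_setT mu) mule1.
  rewrite EFinD leeD2rE//; apply => z; have := fM z; rewrite ler_norml.
  by move=> /andP[+ _]; rewrite -lerBlDr sub0r.
move=> f cf; apply/eqP; rewrite eq_le le//=.
have cNf : continuous (fun z => - f z) by move=> z; apply: cvgN; exact: cf.
have := le _ cNf; rewrite (_ : L (fun z => - f z) = - L f); last first.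
  by rewrite -mulN1r -(pfZ HL)//; congr L; apply/funext => z; rewrite mulN1r.
under eq_integral do rewrite EFinN.
rewrite integralN/=; last exact/integrable_add_def/continuous_integrable.
by rewrite EFinN leeN2.
Qed.
End RieszRepresentation.

(** * Birkhoff averages *)

Section RealIntegrals.
Context {R : realType} {Z : pseudoPMetricType R} (mu : probability (borel Z) R).
Hypothesis cptZ : compact [set: Z].
Implicit Types g h : Z -> R.

Lemma EFin_Rintegral g : continuous g ->
  (\int[mu]_z (g z)%:E)%E = (\int[mu]_z g z)%:E.
Proof.
move=> cg; rewrite /Rintegral fineK//.
by apply: integrable_fin_num => //; exact: continuous_integrable.
Qed.

Lemma Rintegral_positive : positive_functional (fun g => \int[mu]_z g z).
Proof.
split.
- move=> a g h cg ch; rewrite RintegralD//; try exact: continuous_integrable.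
    by rewrite RintegralZl//; exact: continuous_integrable.
  by apply: continuous_integrable => // z; apply: cvgMr; exact: cg.
- by move=> g _ g0; exact: Rintegral_ge0.
- by rewrite Rintegral_cst// mul1r [X in fine X](probability_setT mu).
Qed.

Lemma invariant_Rintegral (U : Z -> Z) g : continuous U -> continuous g ->
  @invariant_measure R _ (borel Z) U mu ->
  \int[mu]_z g (U z) = \int[mu]_z g z.
Proof.
move=> cU cg invU; have mU := borel_measurable_map cU.
rewrite /Rintegral; congr fine.
have mg : measurable_fun [set: borel Z] (EFin \o g).
  by apply/measurable_EFinP; exact: borel_measurable_fun.
have := @integral_pushforward _ _ (borel Z) (borel Z) R U mU mu setT (EFin \o g) mg.
rewrite preimage_setT => <- //; last first.
  by apply: (@continuous_integrable _ _ mu (g \o U)) => // z;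
     apply: continuous_comp; [exact: cU|exact: cg].
by apply: eq_measure_integral => A mA _; exact: invU.
Qed.
End RealIntegrals.

Section Birkhoff.
Context {R : realType} {Z : Type} (U : Z -> Z).

Definition birkhoff (K : nat) (g : Z -> R) (z : Z) : R :=
  K%:R^-1 * \sum_(0 <= j < K) g (iter j U z).

Lemma birkhoff_lin K (a : R) g h z :
  birkhoff K (fun z => a * g z + h z) z = a * birkhoff K g z + birkhoff K h z.
Proof. by rewrite /birkhoff big_split/= -mulr_sumr mulrDr mulrCA. Qed.

Lemma birkhoff_cst K (c : R) z : (0 < K)%N -> birkhoff K (fun=> c) z = c.
Proof.
move=> K0; rewrite /birkhoff sumr_const_nat subn0 -[c *+ K]mulr_natl mulrA.
by rewrite mulVf ?mul1r// pnatr_eq0 -lt0n.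
Qed.

Lemma birkhoff_le K g h z : (forall j, (j < K)%N -> g (iter j U z) <= h (iter j U z)) ->
  birkhoff K g z <= birkhoff K h z.
Proof.
move=> gh; rewrite /birkhoff ler_wpM2l ?invr_ge0 ?ler0n//.
by apply: ler_sum_nat => j /andP[_ jK]; exact: gh.
Qed.

Lemma birkhoff_coboundary K g z :
  birkhoff K (fun z => g (U z) - g z) z = K%:R^-1 * (g (iter K U z) - g z).
Proof.
rewrite /birkhoff; congr (_ * _).
exact: (@telescope_sumr _ 0 K (fun j => g (iter j U z))).
Qed.
End Birkhoff.

Section BirkhoffContinuous.
Context {R : realType} {Z : pseudoPMetricType R} (U : Z -> Z).
Hypothesis cU : continuous U.

Lemma continuous_iter j : continuous (iter j U).
Proof.
elim: j => [|j IH] z; first exact: cvg_id.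
by apply: (@continuous_comp _ _ _ (iter j U) U); [exact: IH|exact: cU].
Qed.

Lemma continuous_birkhoff K (g : Z -> R) : continuous g -> continuous (birkhoff U K g).
Proof.
move=> cg; have cs : continuous (fun z => \sum_(0 <= j < K) g (iter j U z)).
  under eq_fun do rewrite big_mkord.
  apply: (@continuous_sum _ _ K (fun j z => g (iter j U z))) => j z.
  by apply: continuous_comp; [exact: continuous_iter|exact: cg].
by move=> z; apply: cvgMr; exact: cs.
Qed.

Lemma invariant_birkhoff (mu : probability (borel Z) R) K (g : Z -> R) :
  compact [set: Z] -> continuous g -> (0 < K)%N ->
  @invariant_measure R _ (borel Z) U mu ->
  \int[mu]_z birkhoff U K g z = \int[mu]_z g z.
Proof.
move=> cptZ cg K0 invU; have pI := Rintegral_positive mu cptZ.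
have cgj j : continuous (fun z => g (iter j U z)).
  by move=> z; apply: continuous_comp; [exact: continuous_iter|exact: cg].
have invj j : \int[mu]_z g (iter j U z) = \int[mu]_z g z.
  elim: j => [//|j IH]; rewrite -IH.
  rewrite -(invariant_Rintegral cptZ cU (cgj j) invU).
  by apply: eq_Rintegral => z _; rewrite -iterSr.
rewrite /birkhoff (pfZ pI); last by under eq_fun do rewrite big_mkord;
  exact: (@continuous_sum _ _ K (fun j z => g (iter j U z))).
under eq_Rintegral do rewrite big_mkord.
rewrite (@pf_sum _ _ _ pI K (fun j z => g (iter j U z)))//.
under eq_bigr do rewrite invj.
rewrite sumr_const card_ord -[X in _ * X]mulr_natl mulrA mulVf ?mul1r//.
by rewrite pnatr_eq0 -lt0n.
Qed.
End BirkhoffContinuous.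

(** * Finite measurable selections *)

Section FiniteSelection.
Context {R : realType} {Y : pseudoPMetricType R}.

(* A finite-valued measurable choice of centres, so that every function becomes
   integrable once composed with it. *)
Lemma finite_selection (V : Y -> set Y) : compact [set: Y] ->
  (forall y, open (V y)) -> (forall y, V y y) ->
  exists q : Y -> Y, [/\ forall y, V (q y) y,
    forall G : Y -> R, measurable_fun [set: borel Y] ((G \o q) : borel Y -> R) &
    forall G : Y -> R, exists M : R, forall y, `|G (q y)| <= M].
Proof.
rewrite compact_cover => cptY oV VV.
have [D _ covD] := cptY Y setT V (fun y _ => oV y) (fun y _ => ex_intro2 _ _ y I (VV y)).
(* The first centre in the finite subcover whose set contains [y]; on the full list the default
   [point] is never reached. *)
pose q := fix q (s : seq Y) (y : Y) :=
  if s is c :: s' then if `[< V c y >] then c else q s' y else point.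
exists (q (finmap.enum_fset D)); split.
- move=> y; have [c /= cD Vcy] := covD y I.
  have : c \in finmap.enum_fset D by [].
  elim: (finmap.enum_fset D) => [//|c' s IH] /=; rewrite inE.
  case: asboolP => // nV /orP[/eqP cc'|/IH//].
  by case: nV; rewrite -cc'.
- move=> G; elim: (finmap.enum_fset D) => [|c s IH] /=; first exact: measurable_cst.
  rewrite (_ : _ \o _ = fun y => if `[< V c y >] then G c else (G \o q s) y).
    apply: measurable_fun_ifT => //.
    apply: (measurable_fun_bool true).
    rewrite setTI (_ : _ @^-1` _ = V c); first exact: sub_sigma_algebra.
    by apply/seteqP; split => y /=; [move/asboolP|move=> ?; apply/asboolP].
  by apply/funext => y /=; case: ifP.
- move=> G; elim: (finmap.enum_fset D) => [|c s [M HM]] /=; first by exists `|G point|.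
  exists (Num.max `|G c| M) => y; case: ifP => _; first by rewrite le_max lexx.
  by rewrite le_max HM orbT.
Qed.
End FiniteSelection.

(** * Lifting an invariant measure *)

Section Lift.
Context {R : realType} {X Y : pseudoPMetricType R}.
Variables (T : X -> X) (S : Y -> Y) (f : X * Y -> R).
Hypotheses (cptX : compact [set: X]) (cptY : compact [set: Y]).
Hypotheses (cT : continuous T) (cS : continuous S) (cf : continuous f).
Let U := prod_map T S.

Lemma iter_prod_map j z : iter j U z = (iter j T z.1, iter j S z.2).
Proof. by elim: j => [|j /= ->]//; case: z. Qed.

Lemma birkhoff_snd K (h : Y -> R) x y :
  birkhoff U K (fun z => h z.2) (x, y) = birkhoff S K h y.
Proof. by congr (_ * _); apply: eq_bigr => j _; rewrite iter_prod_map. Qed.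

Lemma continuous_prod_map : continuous U.
Proof.
move=> z; apply: cvg_pair.
  by apply: (@continuous_comp _ _ _ fst T); [exact: cvg_fst|exact: cT].
by apply: (@continuous_comp _ _ _ snd S); [exact: cvg_snd|exact: cS].
Qed.

Lemma compact_prodT : compact [set: X * Y].
Proof. by rewrite -setXTT; exact: compact_setX. Qed.

Variable nu : probability (borel Y) R.
Hypothesis invnu : @invariant_measure R _ (borel Y) S nu.
Variable c : R.
Hypothesis low : forall N, exists K, (N <= K)%N /\
  forall y, exists x, birkhoff U K f (x, y) <= c.

(** The functional integrates over [nu] the [K]-step average along the orbit of [(x (q y), q y)].
    Averages of [g \o U - g] telescope to at most [2 * M / K]; the marginal is off by the variation
    of [h] at scale [1 / n.+1], since [q y] shadows [y]. *)
Lemma approximate_lift (n : nat) : exists Ln : (X * Y -> R) -> R,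
  [/\ positive_functional Ln, Ln f <= c,
   forall (g : X * Y -> R) (M : R), (forall z, `|g z| <= M) ->
     Ln (fun z => g (U z) - g z) <= 2 * M / n.+1%:R &
   forall (h : Y -> R) (w : R), continuous h ->
     (forall y y', ball y n.+1%:R^-1 y' -> h y <= h y' + w) ->
     Ln (fun z => h z.2) <= \int[nu]_y h y + w].
Proof.
have [K [nK /choice[x xc]]] := low n.+1.
have K0 : (0 < K)%N by apply: leq_trans nK.
pose r : R := n.+1%:R^-1.
have r0 : 0 < r by rewrite invr_gt0.
(* The Bowen ball of length [K] and radius [r]; interiors are taken because [ball] itself may fail
   to be open. *)
pose V y := \bigcap_(j < K) (iter j S @^-1` (ball (iter j S y) r)^°).
have oV y : open (V y).
  rewrite /V bigcap_mkord; elim/big_ind : _ => //.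
  - exact: openT.
  - by move=> A B; exact: openI.
  - move=> j _; apply: open_comp; last exact: open_interior.
    by move=> z _; exact: continuous_iter.
have VV y : V y y by move=> j _; exact: nbhsx_ballx.
have [q [qV mq bq]] := finite_selection cptY oV VV.
have intq (G : Y -> R) : nu.-integrable setT (EFin \o (fun y : borel Y => G (q y))).
  apply: measurable_bounded_integrable => //.
  - by have := ltry (1 : R); rewrite -(probability_setT nu).
  - exact: mq.
  - have [M GM] := bq G; exists M; split; first exact: num_real.
    by move=> m Mm z _; exact: le_trans (GM z) (ltW Mm).
have nu1 (a : R) : \int[nu]_y a = a.
  by rewrite Rintegral_cst// [X in fine X](probability_setT nu) mulr1.
have intc (a : R) : nu.-integrable setT (EFin \o (fun y : borel Y => a)).
  exact: (intq (fun=> a)).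
pose A (G : X * Y -> R) y := birkhoff U K G (x y, y).
exists (fun G => \int[nu]_y A G (q y)); split; first split.
- move=> a g h _ _; under eq_Rintegral do rewrite /A birkhoff_lin.
  rewrite RintegralD//; last exact: (intq (A h)).
    by rewrite RintegralZl//; exact: (intq (A g)).
  exact: (intq (fun y => a * A g y)).
- move=> g _ g0; apply: Rintegral_ge0 => y _.
  by rewrite /A /birkhoff mulr_ge0 ?invr_ge0 ?ler0n//; apply: sumr_ge0.
- by under eq_Rintegral do rewrite /A birkhoff_cst//.
- rewrite -[leRHS]nu1; apply: le_Rintegral => //.
  by move=> y _; exact: xc.
- move=> g M gM; rewrite -[leRHS]nu1; apply: le_Rintegral => //.
  move=> y _; rewrite /A birkhoff_coboundary mulrC.
  have M0 : 0 <= M by apply: le_trans (gM point); exact: normr_ge0.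
  apply: (@le_trans _ _ (2 * M / K%:R)).
    rewrite ler_pM2r ?invr_gt0 ?ltr0n//.
    have := gM (iter K U (x (q y), q y)); have := gM (x (q y), q y).
    by rewrite !ler_norml; lra.
  rewrite ler_wpM2l ?mulr_ge0// lef_pV2 ?posrE ?ltr0n// ler_nat//.
(* Invariance of [nu] replaces [h] by its [K]-step average, which is compared term by term along the
   orbits of [q y] and [y]. *)
- move=> h w ch hw; rewrite -[w in leRHS]nu1 -(invariant_birkhoff cS cptY ch K0 invnu).
  have cb := @continuous_birkhoff _ _ _ cS K h ch.
  have ib : nu.-integrable setT (EFin \o (birkhoff S K h : borel Y -> R)).
    exact: continuous_integrable.
  rewrite -RintegralD//; apply: le_Rintegral => //.
  + by apply: continuous_integrable => // y; apply: cvgD; [exact: cb|exact: cvg_cst].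
  move=> y _; rewrite /A birkhoff_snd -[X in _ <= _ + X](birkhoff_cst S w y K0).
  rewrite -[X in _ <= X + _]mul1r -birkhoff_lin /birkhoff.
  rewrite ler_wpM2l ?invr_ge0 ?ler0n//; apply: ler_sum_nat => j /andP[_ jK].
  by rewrite mul1r; apply: hw; apply: interior_subset; exact: qV.
Qed.

Lemma low_invariant_lift : exists lam : probability (borel (X * Y)%type) R,
  invariant_lift T S nu lam /\ (\int[lam]_z (f z)%:E <= c%:E)%E.
Proof.
(* X * Y has no canonical pseudoPMetricType structure, hence the packing. *)
pose Z : pseudoPMetricType R := HB.pack (X * Y)%type.
have cptZ := compact_prodT; have cU := continuous_prod_map.
have [Ln HLn] := choice approximate_lift.
have [L HL Llim] : exists2 L, positive_functional L &
    forall (g : X * Y -> R) (c : R), continuous g ->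
    (\forall n \near \oo, Ln n g <= c) -> L g <= c.
  by apply: pf_ultralimit => // n; have [] := HLn n.
have cNg (W : topologicalType) (g : W -> R) : continuous g -> continuous (fun z => - g z).
  by move=> cg z; apply: cvgN; exact: cg.
have LN (g : X * Y -> R) : continuous g -> L (fun z => - g z) = - L g.
  move=> cg; rewrite -mulN1r -(pfZ HL)//.
  by congr L; apply/funext => z; rewrite mulN1r.
have nearV (M e : R) : 0 < e -> \forall n \near \oo, M / n.+1%:R <= e.
  move=> e0; exists (Num.truncn (M / e)) => // n /= Mn.
  rewrite ler_pdivrMr// -ler_pdivrMl// mulrC; apply: le_trans (ltW (truncnS_gt _)) _.
  by rewrite ler_nat.
have LU (g : X * Y -> R) : continuous g -> L (fun z => g (U z)) <= L g.
  move=> cg; have [M M0 gM] := continuous_bounded cptZ cg.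
  have cgU : continuous (fun z => g (U z)).
    by move=> z; apply: continuous_comp; [exact: cU|exact: cg].
  rewrite -subr_le0 -LN// -(pfD HL)//; last exact: cNg.
  apply/ler_addgt0Pr => e e0; rewrite add0r; apply: Llim.
    by move=> z; apply: cvgD; [exact: cgU|exact: cNg].
  near=> n; have [_ _ Hn _] := HLn n; apply: le_trans (Hn g M gM) _.
  by near: n; exact: nearV.
(* The inequality for [- g] turns the one-sided bound into an equality; the same device gives
   [LsndE]. *)
have LUE (g : X * Y -> R) : continuous g -> L (fun z => g (U z)) = L g.
  move=> cg; apply/eqP; rewrite eq_le LU//=.
  have := LU _ (cNg _ _ cg); rewrite !LN ?lerN2//.
  by move=> z; apply: continuous_comp; [exact: cU|exact: cg].
have csnd (h : Y -> R) : continuous h -> continuous (fun z : X * Y => h z.2).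
  by move=> ch z; apply: (@continuous_comp _ _ _ snd h); [exact: cvg_snd|exact: ch].
have Lsnd (h : Y -> R) : continuous h -> L (fun z => h z.2) <= \int[nu]_y h y.
  move=> ch; apply/ler_addgt0Pr => e e0; apply: Llim; first exact: csnd.
  have [d d0 hd] := continuous_unif cptY ch e0.
  near=> n; have [_ _ _ Hn] := HLn n; apply: Hn => // y y' yy'.
  have /hd : ball y d y'.
    apply: le_ball yy'; rewrite -[leLHS]mul1r; near: n; exact: nearV.
  by rewrite ltr_norml; lra.
have LsndE (h : Y -> R) : continuous h -> L (fun z => h z.2) = \int[nu]_y h y.
  move=> ch; apply/eqP; rewrite eq_le Lsnd//=.
  have := Lsnd _ (cNg _ _ ch); rewrite LN; last exact: csnd.
  have -> : \int[nu]_y - h y = - \int[nu]_y h y.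
    rewrite -mulN1r -(pfZ (Rintegral_positive nu cptY))//.
    by apply: eq_Rintegral => y _; rewrite mulN1r.
  by rewrite lerN2.
have [lam lamE] := @riesz_representation R Z L HL cptZ.
exists lam; split; last first.
  rewrite lamE// lee_fin; apply: Llim => //.
  by apply: nearW => n; have [] := HLn n.
split.
  move=> A mA; apply: (@borel_pushforward_unique R Z Z U lam lam cU) => // h ch.
  rewrite lamE; last by move=> z; apply: continuous_comp; [exact: cU|exact: ch].
  by rewrite lamE// LUE.
move=> A mA; apply: (@borel_pushforward_unique R Z Y (@snd X Y) lam nu) => //.
  by move=> z; exact: cvg_snd.
by move=> h ch; rewrite lamE ?LsndE ?(EFin_Rintegral nu cptY)//; exact: csnd.
Unshelve. all: by end_near. Qed.
End Lift.

(** * Measures on periodic orbits *)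

Lemma ereal_between {R : realType} (x y : \bar R) : (x < y)%E ->
  exists c : R, (x < c%:E)%E /\ (c%:E < y)%E.
Proof.
case: x => [x| |]; case: y => [y| |] //.
- rewrite lte_fin => xy; exists ((x + y) / 2); rewrite !lte_fin.
  by split; [rewrite ltr_pdivlMr//|rewrite ltr_pdivrMr//]; lra.
- by move=> _; exists (x + 1); rewrite lte_fin ltry ltrDl ltr01.
- by move=> _; exists (y - 1); rewrite ltNyr lte_fin ltrBlDr ltrDl ltr01.
- by move=> _; exists 0; rewrite ltNyr ltry.
Qed.

Section PeriodicOrbitMeasure.
Context {R : realType} {Y : pseudoPMetricType R} (S : Y -> Y) (y0 : Y) (p : nat).
Hypotheses (p0 : (0 < p)%N) (per : iter p S y0 = y0).

Lemma periodic_orbit_measure : exists nu : probability (borel Y) R,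
  @invariant_measure R _ (borel Y) S nu /\
  forall A : set Y, (forall j, (j < p)%N -> ~ A (iter j S y0)) -> nu A = 0%E.
Proof.
pose m : {measure set (borel Y) -> \bar R} :=
  msum (fun i => \d_(iter i S y0 : borel Y)) p.
have mE A : m A = (\sum_(i < p) \d_(iter i S y0 : borel Y) A)%E by [].
have mT : m setT = p%:R%:E.
  rewrite mE; under eq_bigr do rewrite diracT.
  by rewrite sumEFin sumr_const card_ord.
(* The Dirac mass is only the fallback for zero or infinite total mass, which [p0] and [mT]
   exclude. *)
pose nu : probability (borel Y) R := mnormalize m \d_(y0 : borel Y).
have nuE (A : set (borel Y)) : nu A = (m A * (p%:R^-1)%:E)%E.
  by rewrite /nu/= /mnormalize mT/= eqe pnatr_eq0 -leqn0 leqNgt p0.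
exists nu; split.
  move=> A mA; rewrite !nuE; congr (_ * _)%E; rewrite !mE.
  have dS i : \d_(iter i S y0 : borel Y) (S @^-1` A) =
      \d_(iter i.+1 S y0 : borel Y) A :> \bar R.
    by rewrite !diracE; congr (_%:R%:E); apply/idP/idP; rewrite !inE.
  under eq_bigr do rewrite dS.
  case: p p0 per => [//|p' _ per']; rewrite big_ord_recr/= [in RHS]big_ord_recl/=.
  by rewrite [X in \d_X _]per' addeC.
move=> A nA; rewrite nuE mE big1 ?mul0e// => i _.
by rewrite diracE memNset//; exact: nA.
Qed.
End PeriodicOrbitMeasure.

(** * Lifts of a periodic orbit measure *)

Section PeriodicLift.
Context {R : realType} {X Y : pseudoPMetricType R}.
Variables (T Tinv : X -> X) (S : Y -> Y) (f : X * Y -> R).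
Hypotheses (cptX : compact [set: X]) (cptY : compact [set: Y]).
Hypotheses (hdY : hausdorff_space Y).
Hypotheses (cT : continuous T) (cS : continuous S) (cf : continuous f).
Hypothesis TinvK : cancel Tinv T.
Let U := prod_map T S.

(** Pull [x] back [i] steps to start above [y0], where the sum splits into [N] periods of average at
    least [c]. Shifting the window by [i] exchanges [i < p] terms at either end, an error of at most
    [2 * p * M] in a sum of [N * p] terms. *)
Lemma birkhoff_periodic_le (p : nat) (y0 : Y) (c M : R) (N i : nat) (x : X) :
  (0 < p)%N -> iter p S y0 = y0 -> (forall z, `|f z| <= M) ->
  (forall x, c <= birkhoff U p f (x, y0)) ->
  (0 < N)%N -> (i < p)%N ->
  c - 2 * M / N%:R <= birkhoff U (N * p) f (x, iter i S y0).
Proof.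
move=> p0 per fM low N0 ip.
have p0R : 0 < p%:R :> R by rewrite ltr0n.
have N0R : 0 < N%:R :> R by rewrite ltr0n.
have M0 : 0 <= M by apply: le_trans (fM point); exact: normr_ge0.
pose s n z := \sum_(0 <= j < n) f (iter j U z).
have sD m n z : s (m + n)%N z = s m z + s n (iter m U z).
  rewrite /s (big_cat_nat (leq0n m) (leq_addr n m))/=; congr (_ + _).
  rewrite -{1}[m]add0n big_addn addKn; apply: eq_bigr => j _.
  by rewrite iterD.
have sM n z : `|s n z| <= n%:R * M.
  rewrite /s; apply: le_trans (ler_norm_sum _ _ _) _.
  apply: le_trans (ler_sum_nat (G := fun=> M) _) _; first by move=> j _; exact: fM.
  by rewrite sumr_const_nat subn0 mulr_natl.
have sNp n x0 : n%:R * (p%:R * c) <= s (n * p)%N (x0, y0).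
  elim: n x0 => [|n IH] x0; first by rewrite mul0r /s mul0n big_geq.
  rewrite mulSn sD -natr1 mulrDl mul1r addrC lerD//.
    by have := low x0; rewrite /birkhoff -ler_pdivlMl ?invr_gt0// invrK.
  by rewrite iter_prod_map/= per.
have itK k (z : X) : iter k T (iter k Tinv z) = z.
  by elim: k => [//|k IH]; rewrite iterSr/= TinvK.
pose x0 := iter i Tinv x.
have xE : (x, iter i S y0) = iter i U (x0, y0).
  by rewrite iter_prod_map/= itK.
rewrite /birkhoff -/(s (N * p)%N _) xE ler_pdivlMl; last by rewrite ltr0n muln_gt0 N0.
have := sD i (N * p)%N (x0, y0); rewrite addnC sD => h.
have := sM i (x0, y0); have := sM i (iter (N * p) U (x0, y0)).
have := sNp N x0; rewrite !ler_norml natrM.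
have iM : i%:R * M <= p%:R * M by rewrite ler_wpM2r// ler_nat ltnW.
have -> : N%:R * p%:R * (c - 2 * M / N%:R) = N%:R * (p%:R * c) - 2 * (p%:R * M).
  by field; rewrite gt_eqF.
by move=> h1 /andP[h2 h3] /andP[h4 h5]; lra.
Qed.

(** By invariance [f] may be replaced by its average over [N * p] steps, which is at least
    [c - 2 * M / N] above the orbit, hence almost everywhere for [lam]; then [N] grows. *)
Lemma periodic_lift_ge (p : nat) (y0 : Y) (c : R) (nu : probability (borel Y) R)
    (lam : probability (borel (X * Y)%type) R) :
  (0 < p)%N -> iter p S y0 = y0 ->
  (forall x, c <= birkhoff U p f (x, y0)) ->
  (forall A : set Y, (forall j, (j < p)%N -> ~ A (iter j S y0)) -> nu A = 0%E) ->
  invariant_lift T S nu lam ->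
  (c%:E <= \int[lam]_z (f z)%:E)%E.
Proof.
move=> p0 per low nu0 [invlam marg].
pose Z : pseudoPMetricType R := HB.pack (X * Y)%type.
have cptZ : compact [set: Z] := compact_prodT cptX cptY.
have cU : continuous (U : Z -> Z) := continuous_prod_map cT cS.
have [M M0 fM] := @continuous_bounded R Z cptZ f cf.
rewrite (@EFin_Rintegral R Z lam cptZ f cf) lee_fin.
pose O : set (borel Y) := [set iter i S y0 | i in `I_p].
have mO : measurable O.
  rewrite -(setCK O); apply: measurableC; apply: sub_sigma_algebra.
  apply: closed_openC; apply: (accessible_finite_set_closed.1 (hausdorff_accessible hdY)).
  by apply: finite_image; exact: finite_II.
pose B : set (borel Z) := (@snd X Y) @^-1` (~` O).
have mB : measurable B.
  have := @borel_measurable_map R Z Y (@snd X Y) _ measurableT (~` O) (measurableC mO).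
  by rewrite setTI; apply=> z; exact: cvg_snd.
have lamB : lam B = 0%E.
  rewrite marg; last exact: measurableC.
  by apply: nu0 => j jp; apply; exists j.
have key N : (0 < N)%N -> c - 2 * M / N%:R <= \int[lam]_z f z.
  move=> N0; have Np0 : (0 < N * p)%N by rewrite muln_gt0 N0.
  rewrite -(@invariant_birkhoff R Z U cU lam (N * p) f cptZ cf Np0 invlam).
  set c' := c - _.
  have cb := @continuous_birkhoff R Z U cU (N * p) f cf.
  have ib := @continuous_integrable R Z lam _ cptZ cb.
  (* Adding [k] times the indicator of the null set [B] leaves the integral unchanged and makes the
     lower bound hold everywhere: off the orbit the average is at least [- M]. *)
  pose k := `|c'| + M.
  have k0 : 0 <= k by rewrite addr_ge0// ltW.
  have iB : lam.-integrable setT (EFin \o (fun z : borel Z => \1_B z : R)).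
    apply: integrable_indic => //.
  have ikB : lam.-integrable setT (EFin \o (fun z : borel Z => k * \1_B z)).
    by have := integrableZl measurableT k iB.
  have -> : \int[lam]_z birkhoff U (N * p) f z =
      \int[lam]_z (birkhoff U (N * p) f z + k * \1_B z).
    rewrite RintegralD// (RintegralZl (f := (\1_B : borel Z -> R)))//.
    rewrite [X in k * X](_ : _ = 0) ?mulr0 ?addr0//.
    by rewrite /Rintegral integral_indic// setIT; exact: (congr1 fine lamB).
  have -> : c' = \int[lam]_z c'.
    by rewrite Rintegral_cst// [X in fine X](probability_setT lam) mulr1.
  apply: le_Rintegral => //.
  + by apply: (@continuous_integrable R Z lam (fun=> c') cptZ) => z; exact: cvg_cst.
  + by have := integrableD measurableT ib ikB.
  move=> [x y] _; have [[i /= ip yE]|nO] := pselect (O y).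
    apply: ler_wpDr; first by rewrite mulr_ge0.
    by rewrite -yE; apply: birkhoff_periodic_le.
  rewrite indicE (mem_set (_ : B (x, y)))// mulr1.
  have : - M <= birkhoff U (N * p) f (x, y).
    rewrite -(birkhoff_cst U (- M) (x, y) Np0); apply: birkhoff_le => j _.
    by have := fM (iter j U (x, y)); rewrite ler_norml => /andP[].
  by have := ler_norm c'; rewrite /k; lra.
apply/ler_addgt0Pr => e e0; rewrite -lerBlDr.
apply: le_trans (key (Num.truncn (2 * M / e)).+1 isT); rewrite lerB//.
rewrite ler_pdivrMr ?ltr0n// -ler_pdivrMl// mulrC.
exact: ltW (truncnS_gt _).
Qed.
End PeriodicLift.

(** * Comparison of alpha and delta *)

Section AlphaDelta.
Context {R : realType} {X Y : pseudoPMetricType R}.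
Variables (T Tinv : X -> X) (S Sinv : Y -> Y) (f : X * Y -> R).
Hypotheses (cptX : compact [set: X]) (cptY : compact [set: Y]).
Hypotheses (hdY : hausdorff_space Y).
Hypotheses (cT : continuous T) (cS : continuous S) (cf : continuous f).
Hypothesis TinvK : cancel Tinv T.
Let U := prod_map T S.

Lemma deltaE : delta T S f = limn_esup (fun k =>
  ereal_sup [set ereal_inf [set (birkhoff U k f (x, y))%:E | x in [set: X]] |
    y in [set: Y]]).
Proof.
congr limn_esup; apply/funext => k; congr ereal_sup; congr image.
apply/funext => y; congr ereal_inf; congr image; apply/funext => x.
by congr (_ * _)%:E; apply: eq_bigr => j _; rewrite iter_prod_map.
Qed.

(** [limn_esup] is an infimum of suprema over neighbourhoods of infinity, so some tail has all its
    max-min values below [c]. *)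
Lemma delta_lt (c : R) : (delta T S f < c%:E)%E ->
  forall N, exists K, (N <= K)%N /\
    forall y, exists x, birkhoff U K f (x, y) <= c.
Proof.
rewrite deltaE => /ereal_inf_lt[_ [V [N0 _ N0V] <-]] Vc N.
exists (maxn N N0); split; first exact: leq_maxl.
move=> y; have : (ereal_inf [set (birkhoff U (maxn N N0) f (x, y))%:E |
    x in [set: X]] < c%:E)%E.
  apply: le_lt_trans Vc; apply: le_trans; last first.
    apply: ereal_sup_ubound; exists (maxn N N0); last by reflexivity.
    by apply: N0V; exact: leq_maxr.
  by apply: ereal_sup_ubound; exists y.
by move=> /ereal_inf_lt[_ [x _ <-]]; rewrite lte_fin => /ltW; exists x.
Qed.

Lemma delta_gt (c : R) : (c%:E < delta T S f)%E ->
  forall N, exists K, (N <= K)%N /\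
    exists y, forall x, c <= birkhoff U K f (x, y).
Proof.
rewrite deltaE => cd N.
have /ereal_sup_gt[_ [K NK <-]] := lt_le_trans cd (ereal_inf_lbound
  (ex_intro2 _ _ [set k | (N <= k)%N] (nbhs_infty_ge N) erefl)).
move=> /ereal_sup_gt[_ [y _ <-]] cy; exists K; split => //; exists y => x.
rewrite -lee_fin; apply: le_trans (ltW cy) _.
by apply: ereal_inf_lbound; exists x.
Qed.

Lemma alpha_le_delta : (alpha T S f <= delta T S f)%E.
Proof.
apply: ge_ereal_sup => _ [nu invnu <-]; rewrite leNgt; apply/negP.
move=> /ereal_between[c [dc cpsi]].
have [lam [lift lamc]] := low_invariant_lift cptX cptY cT cS cf invnu (delta_lt dc).
move: cpsi; apply/negP; rewrite -leNgt; apply: le_trans lamc.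
by apply: ereal_inf_lbound; exists lam.
Qed.

(* One traced segment of length K - 1 closes up after a gap of bounded length D,
   which for large K does not affect the averages. *)
Lemma periodic_tracing (c e : R) : periodic_specification S Sinv ->
  (forall N, exists K, (N <= K)%N /\
    exists y, forall x, c <= birkhoff U K f (x, y)) ->
  0 < e -> exists p y0, [/\ (0 < p)%N, iter p S y0 = y0 &
    forall x, c - e <= birkhoff U p f (x, y0)].
Proof.
move=> spec high e0.
pose Z : pseudoPMetricType R := HB.pack (X * Y)%type.
have cptZ : compact [set: Z] := compact_prodT cptX cptY.
have [M M0 fM] := @continuous_bounded R Z cptZ f cf.
have e20 : 0 < e / 2 by rewrite divr_gt0.
have [d d0 fd] := @continuous_unif R Z cptZ f _ cf e20.
have [D HD] := spec d d0.
(* For [m] at least [C], [m * (e / 2)] pays for the dropped last term ([M]), the gap ([D * M]) and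
   the change of length from [m + 1] to [m + D]; tracing uses the other half of [e]. *)
pose C := 2 * (M + D%:R * M + (D%:R + 1) * `|c|) / e.
(* With [K = m + 1], the successor taken twice also forces [m > 0], so the period [m + D] is
   positive even if [D = 0]. *)
have [[|m] [Km [y yc]]] := high (Num.truncn C).+2; first by [].
have Cm : C <= m%:R.
  by apply: le_trans (ltW (truncnS_gt _)) _; rewrite ler_nat.
have [|||y0 [tr per]] := HD 1%N (fun=> y) (fun=> 0) (fun=> m%:Z) isT; try by [].
have {}per : iter (m + D)%N S y0 = y0.
  by move: per; rewrite subr0 -PoszD.
have m0 : (0 < m + D)%N by rewrite ltn_addr//; exact: (leq_ltn_trans (leq0n _) (Km : (Num.truncn C < m)%N)).
exists (m + D)%N, y0; split => // x.
have {}tr j : (j < m)%N -> ball (iter j S y) d (iter j S y0).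
  move=> jm; apply: (tr 0%N isT j%:Z).
  by apply/andP; split => //=; rewrite lez_nat ltnW.
have := yc x; rewrite /birkhoff !ler_pdivlMl ?ltr0n//.
(* Only the indices below [m] are compared: index [m] is traced but lies outside the period when
   [D = 0]. *)
rewrite big_nat_recr//= (big_cat_nat (leq0n m) (leq_addr D m))/=.
set s1 := \sum_(0 <= j < m) _; set s2 := \sum_(0 <= j < m) _; set s3 := \sum_(m <= j < _) _.
have s12 : s1 - m%:R * (e / 2) <= s2.
  rewrite mulr_natl -[X in _ *+ X]subn0 -sumr_const_nat -sumrB.
  apply: ler_sum_nat => j /andP[_ jm].
  have : `|f (iter j U (x, y)) - f (iter j U (x, y0))| < e / 2.
    apply: fd; rewrite !iter_prod_map; split => /=; first exact: ballxx.
    exact: tr.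
  by rewrite ltr_norml; lra.
have s3M : - (D%:R * M) <= s3.
  rewrite mulr_natl -mulNrn -[X in _ *+ X](addKn m) -sumr_const_nat.
  apply: ler_sum_nat => j _.
  by have := fM (iter j U (x, y0)); rewrite ler_norml => /andP[].
have := fM (iter m U (x, y)); rewrite ler_norml => /andP[_ fmM].
move: Cm; rewrite /C ler_pdivrMr// => Cm.
have cn : c <= `|c| := ler_norm c.
have cn' : - c <= `|c| by rewrite -normrN ler_norm.
have D0 : 0 <= D%:R :> R := ler0n _ D.
rewrite -natr1 natrD => hs.
by nra.
Qed.

Lemma delta_le_alpha : periodic_specification S Sinv ->
  (delta T S f <= alpha T S f)%E.
Proof.
move=> spec; rewrite leNgt; apply/negP => /ereal_between[c [ac cd]].
suff : (c%:E <= alpha T S f)%E by rewrite leNgt ac.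
apply/lee_subgt0Pr => e e0.
have [p [y0 [p0 per low]]] := periodic_tracing spec (delta_gt cd) e0.
have [nu [invnu nu0]] := periodic_orbit_measure p0 per.
apply: (@le_trans _ _ (psi T S f nu)); last by apply: ereal_sup_ubound; exists nu.
apply: le_ereal_inf_tmp => _ [lam lift <-].
exact: (periodic_lift_ge cptX cptY hdY cT cS cf TinvK p0 per low nu0 lift).
Qed.
End AlphaDelta.
Unset Implicit Arguments. Set Strict Implicit.

Theorem theorem2p10 (R : realType) (X Y : pseudoPMetricType R)
    (T Tinv : X -> X) (S Sinv : Y -> Y) (f : X * Y -> R) :
  compact [set: X] -> hausdorff_space X ->
  compact [set: Y] -> hausdorff_space Y ->
  continuous T -> continuous Tinv -> cancel T Tinv -> cancel Tinv T ->
  continuous S -> continuous Sinv -> cancel S Sinv -> cancel Sinv S ->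
  continuous f ->
  [/\ (periodic_specification T Tinv -> periodic_specification S Sinv ->
        (alpha T S f <= delta T S f)%E),
      (periodic_specification S Sinv -> (delta T S f <= alpha T S f)%E) &
      (periodic_specification T Tinv -> periodic_specification S Sinv ->
        alpha T S f = delta T S f)].
Proof.
move=> cptX _ cptY hdY cT _ _ TinvK cS _ _ _ cf.
have ad := alpha_le_delta cptX cptY cT cS cf.
have da := @delta_le_alpha R X Y T Tinv S Sinv f cptX cptY hdY cT cS cf TinvK.
split => // _ specS; apply/eqP; rewrite eq_le ad; exact: da.
Qed.
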